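(* Let $q_\varepsilon(t)$ be a space change of the trajectory $t\mapsto q(t)$, $t\in I$, $\theta_\varepsilon(t)$ a time change and $G(\varepsilon,t)$ a BH-function. Suppose that there is infinitesimal alternative BH-invariance under space and time change for $(q_\varepsilon,\theta_\varepsilon,G)$, and that $t\mapsto q(t)$ is a solution to the Lagrange equation. Then the following function is constant in $t\in I$: $$N(t)=\partial_{\dot q}L\bigl(t,q(t),\dot q(t)\bigr)\cdot\Bigl(\partial_\varepsilon q_\varepsilon(t)|_{\varepsilon=0}-(\partial_\varepsilon\theta_\varepsilon(t)|_{\varepsilon=0})\,\dot q(t)\Bigr)+L\bigl(t,q(t),\dot q(t)\bigr)\,\partial_\varepsilon\theta_\varepsilon(t)|_{\varepsilon=0}+\partial_\varepsilon G(\varepsilon,t)|_{\varepsilon=0}.$$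
   Context: Let $n\ge1$ and let $L=L(t,q,\dot q)$ (the Lagrangian) be a smooth real-valued function on an open subset of $\mathbb{R}\times\mathbb{R}^n\times\mathbb{R}^n$. The symbols $\partial_qL,\partial_{\dot q}L$ denote the gradients with respect to the second and third arguments, viewed as vectors of $\mathbb{R}^n$; $x\cdot y$ is the Euclidean inner product; a dot over a function denotes the derivative in $t$. Let $t\mapsto q(t)\in\mathbb{R}^n$ be a smooth trajectory on an open interval $I$ such that $(t,q(t),\dot q(t))$ lies in the domain of $L$ for all $t\in I$. It is a solution to the Lagrange equation if $\frac{d}{dt}\partial_{\dot q}L(t,q(t),\dot q(t))-\partial_qL(t,q(t),\dot q(t))=0$ for all $t\in I$. All functions of $(\varepsilon,t)$ below are defined on an open neighbourhood of $\{0\}\times I$ in $\mathbb{R}\times I$ (i.e. for $t\in I$ and $\varepsilon$ close to $0$). A space change of $q$ is a smooth one-parameter family $(\varepsilon,t)\mapsto q_\varepsilon(t)\in\mathbb{R}^n$ with $q_0(t)=q(t)$ for all $t\in I$. A time change is a smooth real function $(\varepsilon,t)\mapsto\theta_\varepsilon(t)$ with $\theta_0(t)=t$ for all $t\in I$; $\theta_\varepsilon'$ is the derivative in $t$ and $\theta_\varepsilon^{-1}$ the inverse with respect to $t$. A BH-function is a smooth real function $G(\varepsilon,t)$. The Hamiltonian action is $A_{a,b}(q)=\int_a^bL(t,q(t),\dot q(t))\,dt$. Infinitesimal alternative BH-invariance under space and time change for $(q_\varepsilon,\theta_\varepsilon,G)$ means that, with $\tilde q_\varepsilon:=q_\varepsilon\circ\theta_\varepsilon^{-1}$,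 $$\frac{\partial}{\partial\varepsilon}\Bigl(A_{\theta_\varepsilon(a),\theta_\varepsilon(b)}(\tilde q_\varepsilon)+G(\varepsilon,b)-G(\varepsilon,a)\Bigr)\Big|_{\varepsilon=0}=0\quad\forall a,b\in I,$$ equivalently $$\frac{\partial}{\partial\varepsilon}\biggl(L\Bigl(\theta_\varepsilon(t),q_\varepsilon(t),\frac{\dot q_\varepsilon(t)}{\theta_\varepsilon'(t)}\Bigr)\theta_\varepsilon'(t)+\partial_tG(\varepsilon,t)\biggr)\bigg|_{\varepsilon=0}=0\quad\forall t\in I .$$ *)

(* Defs.v *)
From HB Require Import structures.
From mathcomp Require Import all_boot all_order all_algebra.
From mathcomp Require Import all_classical all_reals all_analysis.
Set Implicit Arguments.
Unset Strict Implicit.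
Unset Printing Implicit Defensive.
Import Order.TTheory GRing.Theory Num.Theory.
Import numFieldNormedType.Exports.
Local Open Scope ring_scope.
Local Open Scope classical_set_scope.

(* Class C^k on an open set U, between normed spaces whose source is
   finite-dimensional in all uses below: the derivatives of all orders along
   all vectors suffice to describe the iterated differentials. *)
Fixpoint Ck_on (R : realType) (V W : normedModType R) (k : nat)
    (U : set V) (f : V -> W) : Prop :=
  match k with
  | 0 => forall x, U x -> {for x, continuous f}
  | k'.+1 => (forall x, U x -> differentiable f x) /\
             forall v : V, Ck_on k' U ('D_v f)
  end.

Definition smooth_on (R : realType) (V W : normedModType R)
    (U : set V) (f : V -> W) : Prop :=
  forall k, Ck_on k U f.

Definition gradient (R : realType) (n : nat) (f : 'rV[R]_n -> R)
    (x : 'rV[R]_n) : 'rV[R]_n :=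
  \row_i 'D_(delta_mx 0 i) f x.

Definition dot (R : realType) (n : nat) (x y : 'rV[R]_n) : R :=
  \sum_i x 0 i * y 0 i.

Section Lagrangian.
Variables (R : realType) (n : nat).

(* A Lagrangian is total on triples (t, q, v), with unspecified values outside
   the open set on which it is smooth. *)
Variable L : R * 'rV[R]_n * 'rV[R]_n -> R.

Definition dLq (t : R) (x v : 'rV[R]_n) : 'rV[R]_n :=
  gradient (fun y => L (t, y, v)) x.

Definition dLv (t : R) (x v : 'rV[R]_n) : 'rV[R]_n :=
  gradient (fun w => L (t, x, w)) v.

Definition lagrange_equation (I : set R) (q : R -> 'rV[R]_n) : Prop :=
  forall t, I t ->
    derive1 (fun s => dLv s (q s) (derive1 q s)) t - dLq t (q t) (derive1 q t) = 0.

End Lagrangian.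

Definition oriented_integral (R : realType) (a b : R) (f : R -> R) : R :=
  if a <= b then \int[lebesgue_measure]_(t in `[a, b]) f t
  else - \int[lebesgue_measure]_(t in `[b, a]) f t.

Definition action (R : realType) (n : nat)
    (L : R * 'rV[R]_n * 'rV[R]_n -> R) (a b : R) (q : R -> 'rV[R]_n) : R :=
  oriented_integral a b (fun t => L (t, q t, derive1 q t)).

Definition trajectory (R : realType) (n : nat)
    (D : set (R * 'rV[R]_n * 'rV[R]_n)) (I : set R) (q : R -> 'rV[R]_n) : Prop :=
  smooth_on I q /\ forall t, I t -> D (t, q t, derive1 q t).

(* Functions of (eps, t) are curried, with eps first. *)
Definition smooth_family (R : realType) (W : normedModType R) (I : set R)
    (F : R -> R -> W) : Prop :=
  exists Omega : set (R * R),
    [/\ open Omega, [set 0] `*` I `<=` Omega, Omega `<=` setT `*` I &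
        smooth_on Omega (fun x => F x.1 x.2)].

Definition space_change (R : realType) (n : nat) (I : set R)
    (q : R -> 'rV[R]_n) (Q : R -> R -> 'rV[R]_n) : Prop :=
  smooth_family I Q /\ forall t, I t -> Q 0 t = q t.

Definition time_change (R : realType) (I : set R) (theta : R -> R -> R) : Prop :=
  smooth_family I theta /\ forall t, I t -> theta 0 t = t.

Definition BH_function (R : realType) (I : set R) (G : R -> R -> R) : Prop :=
  smooth_family I G.

(* For fixed eps, theta eps need not be injective on its whole domain, but it
   is on any compact subinterval of I once eps is close enough to 0. So for
   the integral between theta eps a and theta eps b the inverse is that of
   theta eps restricted to the segment of endpoints a and b; only eps near 0
   matters in what follows. *)
Definition changed_trajectory (R : realType) (n : nat)
    (Q : R -> R -> 'rV[R]_n) (theta : R -> R -> R) (a b eps : R) :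
    R -> 'rV[R]_n :=
  Q eps \o 'pinv_(fun=> 0) `[Num.min a b, Num.max a b] (theta eps).

Definition infinitesimal_alternative_BH_invariance (R : realType) (n : nat)
    (L : R * 'rV[R]_n * 'rV[R]_n -> R) (I : set R)
    (Q : R -> R -> 'rV[R]_n) (theta G : R -> R -> R) : Prop :=
  forall a b, I a -> I b ->
    is_derive (0 : R) (1 : R)
      (fun eps => action L (theta eps a) (theta eps b)
                    (changed_trajectory Q theta a b eps)
                  + G eps b - G eps a)
      (0 : R).

Definition noether_function (R : realType) (n : nat)
    (L : R * 'rV[R]_n * 'rV[R]_n -> R) (q : R -> 'rV[R]_n)
    (Q : R -> R -> 'rV[R]_n) (theta G : R -> R -> R) (t : R) : R :=
  let dtheta := derive1 (fun eps => theta eps t) 0 in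
  dot (dLv L t (q t) (derive1 q t))
      (derive1 (fun eps => Q eps t) 0 - dtheta *: derive1 q t)
  + L (t, q t, derive1 q t) * dtheta
  + derive1 (fun eps => G eps t) 0.

(* Main.v *)
Require Import Defs.
From HB Require Import structures.
From mathcomp Require Import all_boot all_order all_algebra.
From mathcomp Require Import all_classical all_reals all_analysis.
From mathcomp Require Import measurable_realfun ring lra.
Set Implicit Arguments.
Unset Strict Implicit.
Unset Printing Implicit Defensive.
Import Order.TTheory GRing.Theory Num.Theory.
Import numFieldNormedType.Exports.
Local Open Scope ring_scope.
Local Open Scope classical_set_scope.

(** Along the transformed paths the action is the integral of the transformed
Lagrangian

  f(eps, t) = L(theta_eps(t), q_eps(t), q_eps'(t) / theta_eps'(t)) theta_eps'(t)

over the fixed segment [a, b]: this is the substitution s = theta_eps(t)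
([action_reparametrized]).  Since the segment no longer moves, the derivative
in eps passes under the integral sign ([is_derive_segment_integral]).

The derivative of f in eps at eps = 0 is then a total time derivative.  Write
xi and tau for the variations of q_eps and theta_eps at eps = 0, and
p = dL/dq' for the momentum.  Because time and eps derivatives commute
([mixed_partials_eq]), the velocity q_eps' / theta_eps' has variation
xi' - tau' q', so that

  df/deps = tau dL/dt + dL/dq . xi + p . (xi' - tau' q') + L tau'.

The Lagrange equation says p' = dL/dq, and with it the product rule shows that
the right-hand side is the time derivative of the charge
p . (xi - tau q') + L tau ([is_derive_noether_charge]).  Integrating, the
action between a and b varies by the increment of that charge from a to b
([is_derive_action]).  Invariance says that this increment is cancelled by that
of dG/deps, which is the constancy of N. *)

(** * Derivatives along curves *)

Lemma is_derive1_comp (R : realType) (V W : normedModType R) (F : V -> W)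
    (c : R -> V) (t : R) (dc : V) :
  is_derive t 1 c dc -> differentiable F (c t) ->
  is_derive t 1 (F \o c) ('D_dc F (c t)).
Proof.
move=> cdc dF; have dct : differentiable c t by exact/derivable1_diffP.
apply: DeriveDef.
  by apply/derivable1_diffP; exact: differentiable_comp.
rewrite deriveE; last exact: differentiable_comp.
by rewrite diff_comp //= -[X in 'd F _ X]deriveE // derive_val deriveE.
Qed.

Lemma is_derive1_pair (R : realType) (V W : normedModType R) (f : R -> V)
    (g : R -> W) (t : R) (df : V) (dg : W) :
  is_derive t 1 f df -> is_derive t 1 g dg ->
  is_derive t 1 (fun s => (f s, g s)) (df, dg).
Proof.
move=> fdf gdg.
have dft : differentiable f t by exact/derivable1_diffP.
have dgt : differentiable g t by exact/derivable1_diffP.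
apply: DeriveDef.
  by apply/derivable1_diffP; exact: differentiable_pair.
rewrite deriveE; last exact: differentiable_pair.
by rewrite diff_pair // -!deriveE // !derive_val.
Qed.

Lemma is_derive_coord (R : realType) (V : normedModType R) (n : nat)
    (f : V -> 'rV[R]_n) (x v : V) (df : 'rV[R]_n) (i : 'I_n) :
  is_derive x v f df -> is_derive x v (fun y => f y 0 i) (df 0 i).
Proof.
move=> fdf; have dfx : derivable f x v by [].
apply: DeriveDef; first by move/derivable_mxP : dfx; exact.
by rewrite -[df](@derive_val _ _ _ x v f) derive_mx // mxE.
Qed.

Lemma is_derive_rV (R : realType) (V : normedModType R) (n : nat)
    (f : V -> 'rV[R]_n) (x v : V) (df : 'rV[R]_n) :
  (forall i, is_derive x v (fun y => f y 0 i) (df 0 i)) ->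
  is_derive x v f df.
Proof.
move=> fdf; have dfx : derivable f x v.
  by apply/derivable_mxP => i j; rewrite ord1; exact: ex_derive.
apply: DeriveDef => //; rewrite derive_mx //.
by apply/rowP => i; rewrite mxE derive_val.
Qed.

Lemma is_derive_scale (R : realType) (V : normedModType R) (n : nat)
    (c : V -> R) (f : V -> 'rV[R]_n) (x v : V) (dc : R) (df : 'rV[R]_n) :
  is_derive x v c dc -> is_derive x v f df ->
  is_derive x v (fun y => c y *: f y) (dc *: f x + c x *: df).
Proof.
move=> cdc fdf; apply: is_derive_rV => i.
have fi := is_derive_coord i fdf.
rewrite (_ : (fun _ => _) = c * (fun y => f y 0 i)); last first.
  by apply/funext => y; rewrite mxE.
by apply: is_derive_eq; rewrite !mxE addrC [dc * _]mulrC.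
Qed.

Lemma is_derive_dot (R : realType) (V : normedModType R) (n : nat)
    (f g : V -> 'rV[R]_n) (x v : V) (df dg : 'rV[R]_n) :
  is_derive x v f df -> is_derive x v g dg ->
  is_derive x v (fun y => dot (f y) (g y)) (dot df (g x) + dot (f x) dg).
Proof.
move=> fdf gdg.
have fi i := is_derive_coord i fdf.
have gi i := is_derive_coord i gdg.
rewrite (_ : (fun _ => _) =
    \sum_i ((fun y => f y 0 i) * (fun y => g y 0 i))); last first.
  by apply/funext => y; rewrite /dot fct_sumE.
apply: is_derive_eq; rewrite /dot -big_split /=.
by apply: eq_bigr => i _; rewrite addrC [df 0 i * _]mulrC.
Qed.

(** * The differential of a Lagrangian *)

Lemma derive_sum_vectors (R : realType) (V W : normedModType R) (F : V -> W)
    (p : V) (n : nat) (c : 'I_n -> R) (e : 'I_n -> V) :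
  differentiable F p ->
  'D_(\sum_i c i *: e i) F p = \sum_i c i *: 'D_(e i) F p.
Proof.
move=> dF; rewrite deriveE // linear_sum /=.
by apply: eq_bigr => i _; rewrite linearZ /= deriveE.
Qed.

Lemma derive_slice2 (R : realType) (n : nat) (L : R * 'rV[R]_n * 'rV[R]_n -> R)
    (t : R) (x v u : 'rV[R]_n) :
  'D_u (fun y => L (t, y, v)) x = 'D_((0, u, 0)) L (t, x, v).
Proof.
rewrite /derive; congr (lim (_ @ 0^')); apply/funext => h /=.
by rewrite /shift /= (_ : h *: _ + (t, x, v) = (h *: 0 + t, h *: u + x, h *: 0 + v)) // !scaler0 !add0r.
Qed.

Lemma derive_slice3 (R : realType) (n : nat) (L : R * 'rV[R]_n * 'rV[R]_n -> R)
    (t : R) (x v u : 'rV[R]_n) :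
  'D_u (fun w => L (t, x, w)) v = 'D_((0, 0, u)) L (t, x, v).
Proof.
rewrite /derive; congr (lim (_ @ 0^')); apply/funext => h /=.
by rewrite /shift /= (_ : h *: _ + (t, x, v) = (h *: 0 + t, h *: 0 + x, h *: u + v)) // !scaler0 !add0r.
Qed.

(** The gradients only record slices of [L]; differentiability on the product is
what reassembles them into the full differential, through the decomposition of
a direction on the canonical basis. *)
Lemma derive_Lagrangian (R : realType) (n : nat)
    (L : R * 'rV[R]_n * 'rV[R]_n -> R) (t : R) (x v : 'rV[R]_n)
    (dt : R) (dx dv : 'rV[R]_n) :
  differentiable L (t, x, v) ->
  'D_((dt, dx, dv)) L (t, x, v) =
  dt * 'D_((1, 0, 0)) L (t, x, v) + dot (dLq L t x v) dx + dot (dLv L t x v) dv.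
Proof.
move=> dL.
have -> : (dt, dx, dv) = dt *: (1, 0, 0) +
   \sum_i dx 0 i *: (0, delta_mx 0 i, 0) +
   \sum_i dv 0 i *: (0, 0, delta_mx 0 i) :> R * 'rV[R]_n * 'rV[R]_n.
  have sum1 (f : 'I_n -> R * 'rV[R]_n * 'rV[R]_n) :
      \sum_i f i = (\sum_i (f i).1.1, \sum_i (f i).1.2, \sum_i (f i).2).
    by elim: (index_enum _) => [|i s IH]; rewrite ?big_nil // !big_cons IH.
  rewrite !sum1.
  have addE (p r s : R * 'rV[R]_n * 'rV[R]_n) :
      p + r + s = (p.1.1 + r.1.1 + s.1.1, p.1.2 + r.1.2 + s.1.2,
                   p.2 + r.2 + s.2) by [].
  rewrite addE /=.
  have s0 (W : lmodType R) (g : 'I_n -> R) : \sum_i g i *: (0 : W) = 0.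
    by rewrite big1 // => i _; rewrite scaler0.
  rewrite !s0 -!row_sum_delta /=.
  by rewrite !scaler0 !addr0 !add0r [_%:A]mulr1.
rewrite (deriveE _ dL) linearD linearD linearZ /= -!(deriveE _ dL).
rewrite !derive_sum_vectors //.
rewrite /dot /dLq /dLv /gradient; congr (_ + _ + _).
  by apply: eq_bigr => i _; rewrite mxE derive_slice2 mulrC.
by apply: eq_bigr => i _; rewrite mxE derive_slice3 mulrC.
Qed.

(** * Partial derivatives of families *)

(** The second difference over a square is the increment on [[a, a + h]] of
[f ^~ (b + h) - f ^~ b]; a mean value theorem in each variable turns it into a
mixed derivative at some point of the square. *)
Lemma second_difference_mvt (R : realType) (f f1 f21 : R -> R -> R)
    (a b h : R) :
  0 < h ->
  (forall e t, e \in `[a, a + h]%R -> t \in `[b, b + h]%R ->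
     is_derive e 1 (f ^~ t) (f1 e t)) ->
  (forall e t, e \in `[a, a + h]%R -> t \in `[b, b + h]%R ->
     is_derive t 1 (f1 e) (f21 e t)) ->
  exists e t, [/\ e \in `[a, a + h]%R, t \in `[b, b + h]%R &
    f (a + h) (b + h) - f a (b + h) - f (a + h) b + f a b = f21 e t * h * h].
Proof.
move=> h0 df df1.
have aah : a < a + h by rewrite ltrDl.
have bbh : b < b + h by rewrite ltrDl.
have [bb bhb] : b \in `[b, b + h]%R /\ b + h \in `[b, b + h]%R.
  by rewrite !bound_itvE ltW.
have subcc c : `]c, c + h[ `<=` `[c, c + h].
  by apply: subset_itv_oo_cc.
pose g : R -> R := (f ^~ (b + h)) - (f ^~ b).
have dg e : e \in `[a, a + h]%R -> is_derive e 1 g (f1 e (b + h) - f1 e b).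
  by move=> eI; have := df e _ eI bb; have := df e _ eI bhb; exact: is_deriveB.
have [|e eI ge] := MVT aah (fun e eI => dg e (subcc _ _ eI)).
  by apply: derivable_within_continuous => e eI; have := dg e eI.
have eI' := subcc _ _ eI.
have [|t tI f1t] := MVT bbh (fun t tI => df1 e t eI' (subcc _ _ tI)).
  by apply: derivable_within_continuous => t tI; have := df1 e t eI' tI.
exists e, t; split; rewrite ?eI' //; first exact: subcc.
move: ge; rewrite f1t /g /= !fctE.
have -> : a + h - a = h by ring.
have -> : b + h - b = h by ring.
by move=> <-; ring.
Qed.

(** Schwarz's theorem.  The second difference over a square does not depend on
the order of the two variables, so small squares carry points where the two
mixed derivatives agree; continuity brings the equality to [(a, b)]. *)
Lemma mixed_partials_eq (R : realType) (f f1 f2 f12 f21 : R -> R -> R)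
    (a b : R) :
  (\forall x \near (a, b),
    [/\ is_derive (x.1 : R) 1 (f ^~ x.2) (f1 x.1 x.2),
        is_derive (x.2 : R) 1 (f x.1) (f2 x.1 x.2),
        is_derive (x.1 : R) 1 (f2 ^~ x.2) (f12 x.1 x.2) &
        is_derive (x.2 : R) 1 (f1 x.1) (f21 x.1 x.2)]) ->
  {for (a, b), continuous (fun x : R * R => f12 x.1 x.2)} ->
  {for (a, b), continuous (fun x : R * R => f21 x.1 x.2)} ->
  f12 a b = f21 a b.
Proof.
move=> df c12 c21; apply/eqP; rewrite -subr_eq0 -normr_le0.
apply/ler_addgt0Pr => e e0; rewrite add0r.
have e20 : 0 < e / 2 by rewrite divr_gt0.
move/cvgrPdist_lt : c12 => /(_ _ e20) c12.
move/cvgrPdist_lt : c21 => /(_ _ e20) c21.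
have [r /= r0 box] := (nbhs_ballP _ _).1 (filterI df (filterI c12 c21)).
(* Half the radius keeps the closed square inside the open ball. *)
pose h := r / 2.
have h0 : 0 < h by rewrite divr_gt0.
have inbox u v : u \in `[a, a + h]%R -> v \in `[b, b + h]%R -> ball (a, b) r (u, v).
  rewrite !in_itv /= => /andP[au uh] /andP[bv vh].
  have hr : h < r by rewrite /h; lra.
  by split; rewrite /ball /= ltr_norml; lra.
have [u [v [uI vI E1]]] := @second_difference_mvt _ f f1 f21 a b h h0
  (fun u v uI vI => let: conj (And4 p _ _ _) _ := box _ (inbox u v uI vI) in p)
  (fun u v uI vI => let: conj (And4 _ _ _ p) _ := box _ (inbox u v uI vI) in p).
have [v' [u' [vI' uI' E2]]] := @second_difference_mvt _ (fun t e => f e t)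
  (fun t e => f2 e t) (fun t e => f12 e t) b a h h0
  (fun v u vI uI => let: conj (And4 _ p _ _) _ := box _ (inbox u v uI vI) in p)
  (fun v u vI uI => let: conj (And4 _ _ p _) _ := box _ (inbox u v uI vI) in p).
have E : f12 u' v' = f21 u v.
  have h2 : h * h != 0 by rewrite mulf_neq0 // gt_eqF.
  by apply: (mulIf h2); rewrite !(mulrA _ h) -[LHS]E2 -[RHS]E1; ring.
have [_ [_ /= d21]] := box _ (inbox u v uI vI).
have [_ [/= d12 _]] := box _ (inbox u' v' uI' vI').
rewrite -(subrKA (f12 u' v')) [in X in _ + X]E.
rewrite (le_trans (ler_normD _ _)) // (splitr e) lerD ?(ltW d12) //.
by rewrite distrC ltW.
Qed.

(** * Differentiation under the integral over a segment *)

(** The tube lemma: by compactness the neighbourhoods of the points [(e0, t)]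
contain a common strip around [e0]. *)
Lemma near_segment (R : realType) (P : R * R -> Prop) (a b e0 : R) :
  (forall t, t \in `[a, b]%R -> \forall x \near (e0, t), P x) ->
  \forall e \near e0, forall t, t \in `[a, b]%R -> P (e, t).
Proof.
move=> nP; have := iffLR (compact_near_coveringP _) (@segment_compact _ a b).
move=> /(_ _ (nbhs e0) (fun e t => P (e, t)) _); apply => t tab.
have swap_cvg : (fun p : R * R => (p.2, p.1)) @ (t, e0) --> (e0, t).
  apply: (@cvg_pair _ _ _ (nbhs (t, e0)) (nbhs e0) (nbhs t)).
    exact: cvg_snd.
  exact: cvg_fst.
exact: swap_cvg (nP t tab).
Qed.

Lemma continuous_section (R : realType) (W : normedModType R) (f : R -> R -> W)
    (e t : R) :
  {for (e, t), continuous (fun x : R * R => f x.1 x.2)} ->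
  {for t, continuous (f e)}.
Proof.
move=> cf; apply: (@continuous_comp _ _ _ (pair e) (fun x => f x.1 x.2)) => //.
apply: (@cvg_pair _ _ _ (nbhs t) (nbhs e) (nbhs t)); first exact: cvg_cst.
exact: cvg_id.
Qed.

Lemma continuous_within_segment (R : realType) (W : normedModType R)
    (f : R -> W) (a b : R) :
  (forall t, t \in `[a, b]%R -> {for t, continuous f}) ->
  {within `[a, b], continuous f}.
Proof.
by move=> cf; apply: continuous_in_subspaceT => t /set_mem; exact: cf.
Qed.

(** Leibniz's rule.  Continuity of [f1] on the compact set [{e0} x [a, b]] bounds
[f1] on a strip around it, and a constant dominates on a segment. *)
Lemma is_derive_segment_integral (R : realType) (f f1 : R -> R -> R)
    (a b e0 : R) :
  a < b ->
  (forall t, t \in `[a, b]%R -> \forall x \near (e0, t),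
     is_derive (x.1 : R) 1 (f ^~ x.2) (f1 x.1 x.2)) ->
  (forall t, t \in `[a, b]%R -> \forall x \near (e0, t),
     {for x, continuous (fun x : R * R => f x.1 x.2)}) ->
  (forall t, t \in `[a, b]%R ->
     {for (e0, t), continuous (fun x : R * R => f1 x.1 x.2)}) ->
  is_derive e0 1 (fun e => \int[lebesgue_measure]_(t in `[a, b]) f e t)
    (\int[lebesgue_measure]_(t in `[a, b]) f1 e0 t).
Proof.
move=> ab df cf cf1.
have cf1e0 : {within `[a, b], continuous (fun t => `|f1 e0 t|)}.
  apply: continuous_within_segment => t tab.
  apply: (@continuous_comp _ _ _ (f1 e0) Num.norm); last exact: norm_continuous.
  exact: continuous_section (cf1 t tab).
have [m mab maxm] := EVT_max (ltW ab) cf1e0.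
pose M : R := `|f1 e0 m| + 1.
have : \forall e \near e0, forall t, t \in `[a, b]%R ->
    [/\ is_derive (e : R) 1 (f ^~ t) (f1 e t),
        {for (e, t), continuous (fun x : R * R => f x.1 x.2)} &
        `|f1 e t| <= M].
  apply: (@near_segment _ (fun x => [/\ is_derive (x.1 : R) 1 (f ^~ x.2) (f1 x.1 x.2),
     {for x, continuous (fun x : R * R => f x.1 x.2)} & `|f1 x.1 x.2| <= M])).
  move=> t tab; have f1t := maxm t tab.
  have /cvgrPdist_lt/(_ 1 ltr01) bnd := cf1 t tab.
  near=> x; split.
  - by near: x; exact: df.
  - by near: x; exact: cf.
  - have : `|f1 e0 t - f1 x.1 x.2| < 1 by near: x; exact: bnd.
    have := ler_normD (f1 e0 t) (f1 x.1 x.2 - f1 e0 t).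
    by rewrite subrKC distrC /M; move: f1t; lra.
move=> /nbhs_ballP[r /= r0 box].
pose u := e0 - r; pose v := e0 + r.
have uve0 : `]u, v[ e0 by rewrite /= in_itv /= /u /v; lra.
have {}box e : `]u, v[ e -> forall t, t \in `[a, b]%R ->
    [/\ is_derive (e : R) 1 (f ^~ t) (f1 e t),
        {for (e, t), continuous (fun x : R * R => f x.1 x.2)} &
        `|f1 e t| <= M].
  move=> /=; rewrite in_itv /= /u /v => uve t tab; apply: box tab.
  by rewrite /ball /= ltr_norml; lra.
have pE e t : `]u, v[ e -> `[a, b] t -> partial1of2 f e t = f1 e t.
  by move=> eI tI; have [d _ _] := box e eI t tI; rewrite partial1of2E derive_val.
have intf e : `]u, v[ e -> (@lebesgue_measure R).-integrable `[a, b] (EFin \o f e).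
  move=> eI; apply: continuous_compact_integrable; first exact: segment_compact.
  apply: continuous_within_segment => t tI.
  by have [_ /continuous_section] := box e eI t tI.
have derf e t : `]u, v[ e -> `[a, b] t -> derivable (f ^~ t) e 1.
  by move=> eI tI; have [d _ _] := box e eI t tI.
have M0 (y : R) : 0 <= cst M y by rewrite /= /M addr_ge0.
have intM : (@lebesgue_measure R).-integrable `[a, b] (EFin \o cst M).
  apply: continuous_compact_integrable; first exact: segment_compact.
  by apply: continuous_within_segment => t _; exact: cst_continuous.
have bndM e t : `]u, v[ e -> `[a, b] t -> `|partial1of2 f e t| <= cst M t.
  by move=> eI tI; rewrite pE //; have [_ _] := box e eI t tI.
have [der val] :
    derivable (fun e => \int[lebesgue_measure]_(t in `[a, b]) f e t) e0 1 /\
    (fun e => \int[lebesgue_measure]_(t in `[a, b]) f e t)^`() e0 =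
    \int[lebesgue_measure]_(t in `[a, b]) partial1of2 f e0 t.
  by split; [apply: (derivable_under_integral _ uve0 intf derf M0 intM bndM)
            |apply: (differentiation_under_integral _ uve0 intf derf M0 intM bndM)].
apply: DeriveDef => //; rewrite -derive1E val.
by apply: eq_Rintegral => t /set_mem tI; rewrite -pE.
Unshelve. all: by end_near. Qed.

(** * The action of a reparametrized trajectory *)

(** The substitution [s = theta t]: the inverse [g] of [theta] on the segment has
derivative [1 / theta'], so [q \o g] has velocity [q' / theta'] at time
[theta t]. *)
Lemma action_reparametrized (R : realType) (n : nat)
    (L : R * 'rV[R]_n * 'rV[R]_n -> R) (q : R -> 'rV[R]_n) (theta : R -> R)
    (a b : R) :
  a < b ->
  (forall t, t \in `[a, b]%R -> derivable q t 1) ->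
  (forall t, t \in `[a, b]%R -> derivable theta t 1) ->
  (forall t, t \in `[a, b]%R -> {for t, continuous (derive1 theta)}) ->
  (forall t, t \in `[a, b]%R -> 0 < derive1 theta t) ->
  (forall t, t \in `[a, b]%R -> {for t, continuous
     (fun t => L (theta t, q t, (derive1 theta t)^-1 *: derive1 q t))}) ->
  action L (theta a) (theta b) (q \o 'pinv_(fun=> 0) `[a, b] theta) =
  \int[lebesgue_measure]_(t in `[a, b])
    (L (theta t, q t, (derive1 theta t)^-1 *: derive1 q t) * derive1 theta t).
Proof.
move=> ab dq dth cth' th'0 cl.
pose l t := L (theta t, q t, (derive1 theta t)^-1 *: derive1 q t).
set g := 'pinv_(fun=> 0) `[a, b] theta.
have sub_oo_cc : {subset `]a, b[%R <= `[a, b]%R}.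
  by move=> t; rewrite !in_itv /= => /andP[/ltW -> /ltW ->].
have cth : {within `[a, b], continuous theta}.
  by apply: derivable_within_continuous => t tI; exact: dth.
have thlt : {in `[a, b]%R &, {homo theta : x y / x < y}}.
  by apply: gtr0_derive1_lt_cc => // t /sub_oo_cc tI; [exact: dth|exact: th'0].
have thinj : {in `[a, b]%R &, injective theta}.
  move=> x y xI yI xy; have [xy'|yx'|//] := ltgtP x y.
    by have := thlt _ _ xI yI xy'; rewrite xy ltxx.
  by have := thlt _ _ yI xI yx'; rewrite xy ltxx.
have [aI bI] : a \in `[a, b]%R /\ b \in `[a, b]%R by rewrite !in_itv /= !lexx ltW.
have thab : theta a < theta b by exact: thlt.
have thK : {in `[a, b]%R, cancel theta g}.
  by rewrite -[mem _]mem_setE; apply: pinvKV; rewrite !mem_setE.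
have th_onto s : s \in `[theta a, theta b]%R -> exists2 t, t \in `[a, b]%R & theta t = s.
  move=> sI; have := segment_continuous_le_surjective (ltW ab) (ltW thab) cth.
  by move=> /(_ s sI)[t tI <-]; exists t.
have th_onto_oo s : s \in `]theta a, theta b[%R -> exists2 t, t \in `]a, b[%R & theta t = s.
  rewrite in_itv /= => /andP[as' sb].
  have [|t tI ts] := th_onto s; first by rewrite in_itv /= !ltW.
  exists t => //; move: tI; rewrite !in_itv /= !le_eqVlt => /andP[/orP[/eqP ta|->]].
    by move: as'; rewrite -ts ta ltxx.
  by move=> /orP[/eqP tb|->//]; move: sb; rewrite -ts tb ltxx.
have cg : {within `[theta a, theta b], continuous g}.
  exact: segment_can_le_continuous (ltW ab) cth thK.
have clg : {within `[theta a, theta b], continuous (l \o g)}.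
  apply/subspace_continuousP => s sI.
  have [t tI ts] := th_onto s sI.
  apply: (@cvg_comp _ _ _ g l _ (nbhs (g s))).
    by move/subspace_continuousP : cg; exact.
  by rewrite /from_subspace /= -ts thK //; exact: cl.
(* The inverse is set to 0 outside the segment, so nothing is known of the
   derivative at the endpoints, which form a null set. *)
have integrandE s : s \in `]theta a, theta b[%R ->
    L (s, (q \o g) s, derive1 (q \o g) s) = (l \o g) s.
  move=> /th_onto_oo[t tI <-]; have tI' := sub_oo_cc _ tI.
  have nI : \near t, t \in `[a, b]%R.
    near=> u; apply: sub_oo_cc; near: u.
    exact: near_in_itvoo tI.
  have dg : is_derive (theta t) 1 g (derive1 theta t)^-1.
    apply: (@is_derive_inverse _ theta).
    - by near=> u; apply: thK; near: u.
    - near=> u; have uI : u \in `[a, b]%R by near: u.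
      by apply: differentiable_continuous; apply/derivable1_diffP; exact: dth.
    - by rewrite derive1E; apply/derivableP; exact: dth.
    - by rewrite gt_eqF // th'0.
  have dqgt : differentiable q (g (theta t)).
    by rewrite thK //; apply/derivable1_diffP; exact: dq.
  have dqg := is_derive1_comp dg dqgt.
  rewrite derive1E derive_val /= /l thK //.
  rewrite deriveE; last by apply/derivable1_diffP; exact: dq.
  by rewrite diff1E //; apply/derivable1_diffP; exact: dq.
have mlg : measurable_fun `]theta a, theta b[ (l \o g).
  apply: subspace_continuous_measurable_fun => //.
  by apply: continuous_subspaceW clg; exact: subset_itv_oo_cc.
rewrite /action /oriented_integral (ltW thab) /Rintegral.
rewrite (@eq_integral_itv_bounded _ _ _ (l \o g)) //; last first.
  by apply: eq_measurable_fun mlg => s /set_mem sI; rewrite -integrandE.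
have cth_at x : x \in `[a, b]%R -> {for x, continuous theta}.
  by move=> xI; apply: differentiable_continuous; apply/derivable1_diffP; exact: dth.
have cth'_oo : {in `]a, b[%R, continuous (derive1 theta)}.
  by move=> t /sub_oo_cc tI; exact: cth'.
have cvg_a : cvg (derive1 theta x @[x --> a^'+]).
  by apply: (cvgP (derive1 theta a)); apply: cvg_at_right_filter; exact: cth'.
have cvg_b : cvg (derive1 theta x @[x --> b^'-]).
  by apply: (cvgP (derive1 theta b)); apply: cvg_at_left_filter; exact: cth'.
have th_bnd : derivable_oo_LRcontinuous theta a b.
  split; first by move=> t /sub_oo_cc tI; exact: dth.
    by apply: cvg_at_right_filter; exact: cth_at.
  by apply: cvg_at_left_filter; exact: cth_at.
congr fine; apply: etrans (integration_by_substitution_increasing (ltW ab) thlt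
  cth'_oo cvg_a cvg_b th_bnd clg) _.
apply: eq_integral => t /set_mem tI.
congr EFin.
by rewrite fctE /= thK.
Unshelve. all: by end_near. Qed.

(** * Smooth families *)

Definition d_eps (R : realType) (W : normedModType R) (F : R -> R -> W)
    (e t : R) : W := derive1 (F ^~ t) e.

Definition d_time (R : realType) (W : normedModType R) (F : R -> R -> W)
    (e t : R) : W := derive1 (F e) t.

Definition uncurry (R : realType) (W : normedModType R) (F : R -> R -> W)
    (x : R * R) : W := F x.1 x.2.

Lemma uncurry_d_eps (R : realType) (W : normedModType R) (F : R -> R -> W) :
  uncurry (d_eps F) = 'D_((1, 0)) (uncurry F).
Proof.
apply/funext => -[e t]; rewrite /uncurry /d_eps derive1E /derive /=.
congr (lim (_ @ 0^')); apply/funext => h /=.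
by rewrite /shift /= scaler0 add0r.
Qed.

Lemma uncurry_d_time (R : realType) (W : normedModType R) (F : R -> R -> W) :
  uncurry (d_time F) = 'D_((0, 1)) (uncurry F).
Proof.
apply/funext => -[e t]; rewrite /uncurry /d_time derive1E /derive /=.
congr (lim (_ @ 0^')); apply/funext => h /=.
by rewrite /shift /= scaler0 add0r.
Qed.

Lemma smooth_family_derive (R : realType) (W : normedModType R) (I : set R)
    (F G : R -> R -> W) (v : R * R) :
  uncurry G = 'D_v (uncurry F) -> smooth_family I F -> smooth_family I G.
Proof.
move=> GF [Om [oOm IOm OmI sF]]; exists Om; split => // k.
by have [_ /(_ v)] := sF k.+1; rewrite -GF.
Qed.

Lemma smooth_family_d_eps (R : realType) (W : normedModType R) (I : set R)
    (F : R -> R -> W) :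
  smooth_family I F -> smooth_family I (d_eps F).
Proof. exact: smooth_family_derive (uncurry_d_eps F). Qed.

Lemma smooth_family_d_time (R : realType) (W : normedModType R) (I : set R)
    (F : R -> R -> W) :
  smooth_family I F -> smooth_family I (d_time F).
Proof. exact: smooth_family_derive (uncurry_d_time F). Qed.

Lemma smooth_family_differentiable (R : realType) (W : normedModType R)
    (I : set R) (F : R -> R -> W) (t : R) :
  smooth_family I F -> I t ->
  \forall x \near ((0, t) : R * R), differentiable (uncurry F) x.
Proof.
move=> [Om [oOm IOm _ sF]] It; have [dF _] := sF 1.
have : nbhs ((0, t) : R * R) Om by apply: open_nbhs_nbhs; split => //; exact: IOm.
by apply: filterS => x /dF.
Qed.

Lemma smooth_family_continuous (R : realType) (W : normedModType R)
    (I : set R) (F : R -> R -> W) (t : R) :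
  smooth_family I F -> I t -> {for (0, t), continuous (uncurry F)}.
Proof.
move=> sF It; apply: differentiable_continuous.
exact: nbhs_singleton (smooth_family_differentiable sF It).
Qed.

Lemma is_derive_eps (R : realType) (W : normedModType R) (F : R -> R -> W)
    (x : R * R) :
  differentiable (uncurry F) x ->
  is_derive x.1 (1 : R) (F ^~ x.2) (d_eps F x.1 x.2).
Proof.
case: x => e t /= dF; rewrite /d_eps derive1E; apply: derivableP.
have dc : is_derive e 1 (fun u : R => (u, t)) (1, 0) by exact: is_derive1_pair.
by have [] := is_derive1_comp dc dF.
Qed.

Lemma is_derive_time (R : realType) (W : normedModType R) (F : R -> R -> W)
    (x : R * R) :
  differentiable (uncurry F) x ->
  is_derive x.2 (1 : R) (F x.1) (d_time F x.1 x.2).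
Proof.
case: x => e t /= dF; rewrite /d_time derive1E; apply: derivableP.
have dc : is_derive t 1 (fun u : R => (e, u)) (0, 1) by exact: is_derive1_pair.
by have [] := is_derive1_comp dc dF.
Qed.

(** Schwarz's theorem for a family with values in a normed space, tested against
a functional equal to its own differential; the identity and the coordinates
are the ones of interest. *)
Lemma functional_d_eps_d_time (R : realType) (W : normedModType R)
    (phi : W -> R) (I : set R) (F : R -> R -> W) (t : R) :
  (forall w, differentiable phi w) -> (forall w v, 'D_v phi w = phi v) ->
  smooth_family I F -> I t ->
  phi (d_eps (d_time F) 0 t) = phi (d_time (d_eps F) 0 t).
Proof.
move=> dphi phiE sF It.
have s1 := smooth_family_d_eps sF.
have s2 := smooth_family_d_time sF.
have s12 := smooth_family_d_eps s2.
have s21 := smooth_family_d_time s1.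
have along (c : R -> W) (u : R) dc : is_derive u 1 c dc ->
    is_derive u (1 : R) (phi \o c) (phi dc).
  move=> cdc; rewrite -(phiE (c u)).
  exact: (is_derive1_comp cdc (dphi _)).
have cphi (H : R -> R -> W) : smooth_family I H ->
    {for (0, t), continuous (fun x : R * R => phi (H x.1 x.2))}.
  move=> sH; apply: (@continuous_comp _ _ _ (uncurry H) phi).
    exact: smooth_family_continuous sH It.
  exact: differentiable_continuous.
pose ph (H : R -> R -> W) e u := phi (H e u).
apply: (@mixed_partials_eq _ (ph F) (ph (d_eps F)) (ph (d_time F))
  (ph (d_eps (d_time F))) (ph (d_time (d_eps F)))); try exact: cphi.
near=> x.
have dF : differentiable (uncurry F) x.
  by near: x; exact: smooth_family_differentiable sF It.
have d1F : differentiable (uncurry (d_eps F)) x.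
  by near: x; exact: smooth_family_differentiable s1 It.
have d2F : differentiable (uncurry (d_time F)) x.
  by near: x; exact: smooth_family_differentiable s2 It.
split.
- exact: along (is_derive_eps dF).
- exact: along (is_derive_time dF).
- exact: along (is_derive_eps d2F).
- exact: along (is_derive_time d1F).
Unshelve. all: by end_near. Qed.

Lemma d_eps_d_time (R : realType) (I : set R) (F : R -> R -> R) (t : R) :
  smooth_family I F -> I t ->
  d_eps (d_time F) 0 t = d_time (d_eps F) 0 t.
Proof.
apply: (functional_d_eps_d_time (phi := id)) => w; first exact: ex_diff.
by move=> v; rewrite derive_id.
Qed.

Lemma d_eps_d_time_rV (R : realType) (n : nat) (I : set R)
    (F : R -> R -> 'rV[R]_n) (t : R) :
  smooth_family I F -> I t ->
  d_eps (d_time F) 0 t = d_time (d_eps F) 0 t.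
Proof.
move=> sF It; apply/rowP => i.
apply: (functional_d_eps_d_time (phi := fun w : 'rV[R]_n => w 0 i) _ _ sF) => //.
  by move=> w; exact: differentiable_coord.
move=> w v.
by have [_ ->] := is_derive_coord i (is_derive_id w v).
Qed.

(** * The transformed_integrand Lagrangian *)

Lemma is_derive_Lagrangian (R : realType) (n : nat)
    (L : R * 'rV[R]_n * 'rV[R]_n -> R) (c : R -> R) (x v : R -> 'rV[R]_n)
    (s dc : R) (dx dv : 'rV[R]_n) :
  is_derive s (1 : R) c dc -> is_derive s (1 : R) x dx ->
  is_derive s (1 : R) v dv -> differentiable L (c s, x s, v s) ->
  is_derive s (1 : R) (fun u => L (c u, x u, v u))
    (dc * 'D_((1, 0, 0)) L (c s, x s, v s) +
     dot (dLq L (c s) (x s) (v s)) dx + dot (dLv L (c s) (x s) (v s)) dv).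
Proof.
move=> hc hx hv dL; rewrite -derive_Lagrangian //.
exact: (is_derive1_comp (is_derive1_pair (is_derive1_pair hc hx) hv) dL).
Qed.

Lemma continuous_dot (R : realType) (T : topologicalType) (n : nat)
    (f g : T -> 'rV[R]_n) (x : T) :
  (forall i, {for x, continuous (fun y => f y 0 i)}) ->
  (forall i, {for x, continuous (fun y => g y 0 i)}) ->
  {for x, continuous (fun y => dot (f y) (g y))}.
Proof.
move=> cf cg; rewrite /dot.
elim: (index_enum _) => [|i s IH].
  have -> : (fun y => \sum_(i <- [::]) f y 0 i * g y 0 i) = cst 0.
    by apply/funext => y; rewrite big_nil.
  exact: cst_continuous.
have -> : (fun y => \sum_(j <- i :: s) f y 0 j * g y 0 j) =
    (fun y => f y 0 i * g y 0 i) + (fun y => \sum_(j <- s) f y 0 j * g y 0 j).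
  by apply/funext => y; rewrite big_cons.
by apply: cvgD; [apply: cvgM; [exact: cf|exact: cg]|exact: IH].
Qed.

Lemma continuous_coord (R : realType) (T : topologicalType) (n : nat)
    (f : T -> 'rV[R]_n) (x : T) (i : 'I_n) :
  {for x, continuous f} -> {for x, continuous (fun y => f y 0 i)}.
Proof.
move=> cf; apply: (@continuous_comp _ _ _ f (fun M : 'rV[R]_n => M 0 i)) => //.
exact: coord_continuous.
Qed.

Definition velocity (R : realType) (n : nat) (Q : R -> R -> 'rV[R]_n)
    (theta : R -> R -> R) (e t : R) : 'rV[R]_n :=
  (d_time theta e t)^-1 *: d_time Q e t.

(** The quotient rule for [d_eps (velocity Q theta)]. *)
Definition d_eps_velocity (R : realType) (n : nat) (Q : R -> R -> 'rV[R]_n)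
    (theta : R -> R -> R) (e t : R) : 'rV[R]_n :=
  (- (d_time theta e t) ^- 2 * d_eps (d_time theta) e t) *: d_time Q e t +
  (d_time theta e t)^-1 *: d_eps (d_time Q) e t.

Definition transformed_integrand (R : realType) (n : nat)
    (L : R * 'rV[R]_n * 'rV[R]_n -> R) (Q : R -> R -> 'rV[R]_n)
    (theta : R -> R -> R) (e t : R) : R :=
  L (theta e t, Q e t, velocity Q theta e t) * d_time theta e t.

(** The chain rule for [d_eps (transformed_integrand L Q theta)]; the explicit
form makes its continuity visible. *)
Definition d_eps_transformed_integrand (R : realType) (n : nat)
    (L : R * 'rV[R]_n * 'rV[R]_n -> R) (Q : R -> R -> 'rV[R]_n)
    (theta : R -> R -> R) (e t : R) : R :=
  let p := (theta e t, Q e t, velocity Q theta e t) in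
  (d_eps theta e t * 'D_((1, 0, 0)) L p +
   dot (dLq L p.1.1 p.1.2 p.2) (d_eps Q e t) +
   dot (dLv L p.1.1 p.1.2 p.2) (d_eps_velocity Q theta e t)) *
  d_time theta e t + L p * d_eps (d_time theta) e t.

(** The points [(eps, t)] at which the change of variables and the chain rule
make sense: the reparametrization is increasing there and the transformed
arguments stay in the domain of the Lagrangian. *)
Definition regular_point (R : realType) (n : nat) (D : set (R * 'rV[R]_n * 'rV[R]_n))
    (Q : R -> R -> 'rV[R]_n) (theta : R -> R -> R) (x : R * R) : Prop :=
  [/\ differentiable (uncurry theta) x /\ differentiable (uncurry Q) x,
      differentiable (uncurry (d_time theta)) x,
      differentiable (uncurry (d_time Q)) x,
      0 < d_time theta x.1 x.2 &
      D (theta x.1 x.2, Q x.1 x.2, velocity Q theta x.1 x.2)].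

Lemma is_derive_transformed_integrand (R : realType) (n : nat)
    (D : set (R * 'rV[R]_n * 'rV[R]_n)) (L : R * 'rV[R]_n * 'rV[R]_n -> R)
    (Q : R -> R -> 'rV[R]_n) (theta : R -> R -> R) (x : R * R) :
  smooth_on D L -> regular_point D Q theta x ->
  is_derive x.1 (1 : R) (transformed_integrand L Q theta ^~ x.2)
    (d_eps_transformed_integrand L Q theta x.1 x.2).
Proof.
move=> sL [[dth dQ] dth' dQ' th'0 Dx].
have [dL _] := sL 1.
have th'n0 : d_time theta x.1 x.2 != 0 by rewrite gt_eqF.
have hth := is_derive_eps dth; have hQ := is_derive_eps dQ.
have hth' := is_derive_eps dth'; have hQ' := is_derive_eps dQ'.
have hV := is_derive_scale (is_deriveV (f := d_time theta ^~ x.2) th'n0 hth') hQ'.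
have hL := is_derive_Lagrangian hth hQ hV (dL _ Dx).
apply: (is_derive_eq (is_deriveM hL hth')).
by rewrite addrC; congr (_ + _); exact: mulrC.
Qed.

Lemma continuous_arguments (R : realType) (n : nat)
    (Q : R -> R -> 'rV[R]_n) (theta : R -> R -> R) (x : R * R) :
  {for x, continuous (uncurry theta)} -> {for x, continuous (uncurry Q)} ->
  {for x, continuous (uncurry (d_time theta))} ->
  {for x, continuous (uncurry (d_time Q))} ->
  0 < d_time theta x.1 x.2 ->
  {for x, continuous (fun y : R * R =>
     (theta y.1 y.2, Q y.1 y.2, velocity Q theta y.1 y.2))}.
Proof.
move=> cth cQ cth' cQ' th'0.
apply: (@cvg_pair _ _ _ (nbhs x) (nbhs (theta x.1 x.2, Q x.1 x.2))
  (nbhs (velocity Q theta x.1 x.2))).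
  exact: (@cvg_pair _ _ _ (nbhs x) (nbhs (theta x.1 x.2)) (nbhs (Q x.1 x.2))).
apply: cvgZ; last exact: cQ'.
by apply: cvgV; [rewrite gt_eqF|exact: cth'].
Qed.

Lemma continuous_transformed_Lagrangian (R : realType) (n : nat)
    (D : set (R * 'rV[R]_n * 'rV[R]_n)) (L : R * 'rV[R]_n * 'rV[R]_n -> R)
    (Q : R -> R -> 'rV[R]_n) (theta : R -> R -> R) (x : R * R) :
  smooth_on D L -> regular_point D Q theta x ->
  {for x, continuous (fun y : R * R =>
     L (theta y.1 y.2, Q y.1 y.2, velocity Q theta y.1 y.2))}.
Proof.
move=> sL [[dth dQ] dth' dQ' th'0 Dx].
apply: (@continuous_comp _ _ _ (fun y : R * R =>
     (theta y.1 y.2, Q y.1 y.2, velocity Q theta y.1 y.2)) L).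
  by apply: continuous_arguments => //; exact: differentiable_continuous.
exact: (sL 0 _ Dx).
Qed.

Lemma continuous_d_eps_transformed_integrand (R : realType) (n : nat)
    (D : set (R * 'rV[R]_n * 'rV[R]_n)) (L : R * 'rV[R]_n * 'rV[R]_n -> R)
    (I : set R) (Q : R -> R -> 'rV[R]_n) (theta : R -> R -> R) (t : R) :
  smooth_on D L -> smooth_family I Q -> smooth_family I theta -> I t ->
  regular_point D Q theta (0, t) ->
  {for (0, t), continuous (uncurry (d_eps_transformed_integrand L Q theta))}.
Proof.
move=> sL sQ sth It reg; have [_ _ _ th'0 Dx] := reg.
have cth := smooth_family_continuous sth It.
have cQ := smooth_family_continuous sQ It.
have sth' := smooth_family_d_time sth; have sQ' := smooth_family_d_time sQ.
have cth' := smooth_family_continuous sth' It.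
have cQ' := smooth_family_continuous sQ' It.
have cP := continuous_arguments cth cQ cth' cQ' th'0.
have cDL v : {for (0, t), continuous (fun y : R * R =>
    'D_v L (theta y.1 y.2, Q y.1 y.2, velocity Q theta y.1 y.2))}.
  apply: (@continuous_comp _ _ _ (fun y : R * R =>
     (theta y.1 y.2, Q y.1 y.2, velocity Q theta y.1 y.2)) ('D_v L)) => //.
  by have [_ /(_ v)] := sL 1; exact.
apply: cvgD; apply: cvgM; last 2 first.
- exact: continuous_transformed_Lagrangian sL reg.
- exact: (smooth_family_continuous (smooth_family_d_eps sth') It).
- apply: cvgD; [apply: cvgD|].
  + apply: cvgM; last exact: cDL.
    exact: (smooth_family_continuous (smooth_family_d_eps sth) It).
  + apply: (@continuous_dot _ _ _ (fun y : R * R =>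
      dLq L (theta y.1 y.2) (Q y.1 y.2) (velocity Q theta y.1 y.2))
      (uncurry (d_eps Q))) => i.
      rewrite (_ : (fun _ => _) = fun y : R * R => 'D_((0, delta_mx 0 i, 0)) L
          (theta y.1 y.2, Q y.1 y.2, velocity Q theta y.1 y.2)); last first.
        by apply/funext => y; rewrite mxE derive_slice2.
      exact: cDL.
    apply: (continuous_coord (f := uncurry (d_eps Q))).
    exact: (smooth_family_continuous (smooth_family_d_eps sQ) It).
  + apply: (@continuous_dot _ _ _ (fun y : R * R =>
      dLv L (theta y.1 y.2) (Q y.1 y.2) (velocity Q theta y.1 y.2))
      (uncurry (d_eps_velocity Q theta))) => i.
      rewrite (_ : (fun _ => _) = fun y : R * R => 'D_((0, 0, delta_mx 0 i)) L
          (theta y.1 y.2, Q y.1 y.2, velocity Q theta y.1 y.2)); last first.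
        by apply/funext => y; rewrite mxE derive_slice3.
      exact: cDL.
    apply: (continuous_coord (f := uncurry (d_eps_velocity Q theta))).
    apply: cvgD; apply: cvgZ.
    * apply: cvgM;
        last exact: (smooth_family_continuous (smooth_family_d_eps sth') It).
      apply: cvgN; apply: cvgV; first by rewrite expf_neq0 // gt_eqF.
      by apply: cvgM; exact: cth'.
    * exact: cQ'.
    * by apply: cvgV; [rewrite gt_eqF|exact: cth'].
    * exact: (smooth_family_continuous (smooth_family_d_eps sQ') It).
- exact: cth'.
Qed.

(** * Noether's theorem *)

Lemma derive1_eq_on_open (R : realType) (W : normedModType R) (I : set R)
    (f g : R -> W) (t : R) :
  open I -> (forall s, I s -> f s = g s) -> I t -> derive1 f t = derive1 g t.
Proof.
move=> oI fg It; rewrite !derive1E; apply: near_eq_derive.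
by apply: filterS (open_nbhs_nbhs (conj oI It)) => s /fg.
Qed.

Lemma d_time_time_change (R : realType) (I : set R) (theta : R -> R -> R)
    (t : R) :
  open I -> (forall s, I s -> theta 0 s = s) -> I t -> d_time theta 0 t = 1.
Proof.
move=> oI th0 It; rewrite /d_time (derive1_eq_on_open oI th0 It) derive1E.
exact: derive_id.
Qed.

Lemma smooth_curve_derivable (R : realType) (W : normedModType R) (I : set R)
    (q : R -> W) (t : R) :
  smooth_on I q -> I t -> derivable q t 1 /\ derivable (derive1 q) t 1.
Proof.
move=> sq It; have [dq1 /(_ 1)[dq2 _]] := sq 2.
split; first exact/derivable1_diffP/dq1.
have -> : derive1 q = 'D_1 q by apply/funext => s; rewrite derive1E.
exact/derivable1_diffP/dq2.
Qed.

Lemma dotDr (R : realType) (n : nat) (x y z : 'rV[R]_n) :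
  dot x (y + z) = dot x y + dot x z.
Proof. by rewrite /dot -big_split; apply: eq_bigr => i _; rewrite mxE mulrDr. Qed.

Lemma dotZr (R : realType) (n : nat) (a : R) (x y : 'rV[R]_n) :
  dot x (a *: y) = a * dot x y.
Proof. by rewrite /dot mulr_sumr; apply: eq_bigr => i _; rewrite mxE mulrCA. Qed.

Lemma dotBr (R : realType) (n : nat) (x y z : 'rV[R]_n) :
  dot x (y - z) = dot x y - dot x z.
Proof. by rewrite dotDr -scaleN1r dotZr mulN1r. Qed.

(** At [eps = 0] the time change has derivative 1 and the transformed arguments
are those of the trajectory, which lie in [D]; both conditions are open. *)
Lemma near_regular_point (R : realType) (n : nat) (D : set (R * 'rV[R]_n * 'rV[R]_n))
    (I : set R) (q : R -> 'rV[R]_n) (Q : R -> R -> 'rV[R]_n)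
    (theta : R -> R -> R) (t : R) :
  open D -> open I -> trajectory D I q -> space_change I q Q ->
  time_change I theta -> I t ->
  \forall x \near ((0, t) : R * R), regular_point D Q theta x.
Proof.
move=> oD oI [sq qD] [sQ Q0] [sth th0] It.
have sth' := smooth_family_d_time sth; have sQ' := smooth_family_d_time sQ.
have th'1 := d_time_time_change oI th0 It.
have Q'q : d_time Q 0 t = derive1 q t by exact: derive1_eq_on_open oI Q0 It.
have cth' := smooth_family_continuous sth' It.
have cP := continuous_arguments (smooth_family_continuous sth It)
  (smooth_family_continuous sQ It) cth' (smooth_family_continuous sQ' It).
near=> x; split.
- split; near: x.
    exact: (smooth_family_differentiable sth It).
  exact: (smooth_family_differentiable sQ It).
- by near: x; exact: (smooth_family_differentiable sth' It).
- by near: x; exact: (smooth_family_differentiable sQ' It).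
- near: x; apply: (cvgr_gt _ cth').
  by rewrite /uncurry /= th'1.
- near: x; apply: cP; first by rewrite th'1.
  apply: open_nbhs_nbhs; split => //=.
  rewrite /velocity th'1 invr1 scale1r Q'q Q0 // th0 //.
  exact: qD.
Unshelve. all: by end_near. Qed.

(** In the Lagrange equation [derive1] is a total operator, so that equation gives
the value of the derivative but not its existence, which comes from the
smoothness of [L] and [q]. *)
Lemma is_derive_momentum (R : realType) (n : nat)
    (D : set (R * 'rV[R]_n * 'rV[R]_n)) (L : R * 'rV[R]_n * 'rV[R]_n -> R)
    (I : set R) (q : R -> 'rV[R]_n) (t : R) :
  smooth_on D L -> trajectory D I q -> lagrange_equation L I q -> I t ->
  is_derive t (1 : R) (fun s => dLv L s (q s) (derive1 q s))
    (dLq L t (q t) (derive1 q t)).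
Proof.
move=> sL [sq qD] sol It.
have [dq dq'] := smooth_curve_derivable sq It.
move/eqP: (sol t It); rewrite subr_eq0 => /eqP <-; rewrite derive1E.
apply: derivableP; apply/derivable_mxP => i j; rewrite ord1.
rewrite (_ : (fun _ => _) = 'D_((0, 0, delta_mx 0 j)) L \o
    (fun s => (s, q s, derive1 q s))); last first.
  by apply/funext => s; rewrite /dLv /gradient mxE derive_slice3.
have hc := is_derive1_pair (is_derive1_pair (is_derive_id t 1)
  (derivableP dq)) (derivableP dq').
have [_ /(_ (0, 0, delta_mx 0 j))[dDL _]] := sL 2.
by have [dp _] := is_derive1_comp hc (dDL _ (qD t It)).
Qed.

(** The conserved quantity without the contribution of the boundary term. *)
Definition noether_charge (R : realType) (n : nat)
    (L : R * 'rV[R]_n * 'rV[R]_n -> R) (q : R -> 'rV[R]_n)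
    (Q : R -> R -> 'rV[R]_n) (theta : R -> R -> R) (t : R) : R :=
  dot (dLv L t (q t) (derive1 q t)) (d_eps Q 0 t - d_eps theta 0 t *: derive1 q t)
  + L (t, q t, derive1 q t) * d_eps theta 0 t.

(** Differentiating [p . (xi - tau q') + L tau] produces [p' . (xi - tau q')], and
[p' = dL/dq] by the Lagrange equation; the terms [tau dL/dq . q'] and
[tau p . q''] cancel against those of the total derivative of [L], and the rest
is the variation of the integrand, once the mixed derivatives are exchanged. *)
Lemma is_derive_noether_charge (R : realType) (n : nat)
    (D : set (R * 'rV[R]_n * 'rV[R]_n)) (L : R * 'rV[R]_n * 'rV[R]_n -> R)
    (I : set R) (q : R -> 'rV[R]_n) (Q : R -> R -> 'rV[R]_n)
    (theta : R -> R -> R) (t : R) :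
  smooth_on D L -> open I -> trajectory D I q -> space_change I q Q ->
  time_change I theta -> lagrange_equation L I q -> I t ->
  is_derive t (1 : R) (noether_charge L q Q theta)
    (d_eps_transformed_integrand L Q theta 0 t).
Proof.
move=> sL oI tq [sQ Q0] [sth th0] sol It; have [sq qD] := tq.
have [dq dq'] := smooth_curve_derivable sq It.
have [dL _] := sL 1.
have hq := derivableP dq; have hq' := derivableP dq'.
have hp := is_derive_momentum sL tq sol It.
have hd (W : normedModType R) (F : R -> R -> W) : smooth_family I F ->
    is_derive t (1 : R) (F 0) (d_time F 0 t).
  move=> sF; exact: (is_derive_time
    (nbhs_singleton (smooth_family_differentiable sF It))).
have hxi := hd _ _ (smooth_family_d_eps sQ).
have htau := hd _ _ (smooth_family_d_eps sth).
have hL := is_derive_Lagrangian (is_derive_id t 1) hq hq' (dL _ (qD t It)).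
have hdot := is_derive_dot hp (is_deriveB hxi (is_derive_scale htau hq')).
apply: (is_derive_eq (is_deriveD hdot (is_deriveM hL htau))).
have th'1 := d_time_time_change oI th0 It.
have Q'q : d_time Q 0 t = derive1 q t by exact: derive1_eq_on_open oI Q0 It.
rewrite /d_eps_transformed_integrand /d_eps_velocity /velocity th'1 Q'q.
rewrite (d_eps_d_time sth It) (d_eps_d_time_rV sQ It) Q0 // th0 //.
rewrite !invr1 expr1n invr1 !scale1r -!derive1E fctE /=.
have collect (a p xi xi' v w : 'rV[R]_n) (tau tau' dtL l : R) :
    dot a (xi - tau *: v) + dot p (xi' - (tau' *: v + tau *: w)) +
    (l * tau' + tau * (1 * dtL + dot a v + dot p w)) =
    (tau * dtL + dot a xi + dot p ((-1 * tau') *: v + xi')) * 1 + l * tau'.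
  by rewrite 2!dotBr 2!dotDr !dotZr; ring.
exact: (collect (dLq L t (q t) (derive1 q t)) (dLv L t (q t) (derive1 q t))
  (d_eps Q 0 t) (d_time (d_eps Q) 0 t) (derive1 q t) (derive1 (derive1 q) t)
  (d_eps theta 0 t) (d_time (d_eps theta) 0 t)
  ('D_((1, 0, 0)) L (t, q t, derive1 q t)) (L (t, q t, derive1 q t))).
Qed.

(** First variation of the action: Leibniz's rule on the fixed segment, then the
fundamental theorem of calculus for the charge. *)
Lemma is_derive_action (R : realType) (n : nat)
    (D : set (R * 'rV[R]_n * 'rV[R]_n)) (L : R * 'rV[R]_n * 'rV[R]_n -> R)
    (I : set R) (q : R -> 'rV[R]_n) (Q : R -> R -> 'rV[R]_n)
    (theta : R -> R -> R) (a b : R) :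
  open D -> smooth_on D L -> open I -> is_interval I -> trajectory D I q ->
  space_change I q Q -> time_change I theta -> lagrange_equation L I q ->
  I a -> I b -> a < b ->
  is_derive (0 : R) (1 : R)
    (fun eps => action L (theta eps a) (theta eps b)
                  (changed_trajectory Q theta a b eps))
    (noether_charge L q Q theta b - noether_charge L q Q theta a).
Proof.
move=> oD sL oI iI tq sQ' sth' sol Ia Ib ab.
have [[sQ _] [sth _]] := (sQ', sth').
have abI t : t \in `[a, b]%R -> I t.
  by rewrite in_itv /=; exact: iI.
have reg t : t \in `[a, b]%R ->
    \forall x \near ((0, t) : R * R), regular_point D Q theta x.
  by move=> /abI It; exact: (near_regular_point oD oI tq sQ' sth' It).
have int_eq : \forall eps \near (0 : R),
    \int[lebesgue_measure]_(t in `[a, b]) transformed_integrand L Q theta eps t =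
    action L (theta eps a) (theta eps b) (changed_trajectory Q theta a b eps).
  have := near_segment reg; apply: filterS => e /= rege.
  rewrite /changed_trajectory min_l ?max_r ?(ltW ab) //.
  rewrite (action_reparametrized ab) //.
  - by move=> t /rege[[_ /is_derive_time[]]].
  - by move=> t /rege[[/is_derive_time[]]].
  - move=> t /rege[_ /differentiable_continuous + _ _ _].
    exact: continuous_section.
  - by move=> t /rege[].
  - move=> t /rege /(continuous_transformed_Lagrangian sL).
    exact: (continuous_section
      (f := fun e t => L (theta e t, Q e t, velocity Q theta e t))).
apply: near_eq_is_derive int_eq _.
have int_charge :
    \int[lebesgue_measure]_(t in `[a, b]) d_eps_transformed_integrand L Q theta 0 t =
    noether_charge L q Q theta b - noether_charge L q Q theta a.
  have dN t : t \in `[a, b]%R -> is_derive t (1 : R)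
      (noether_charge L q Q theta) (d_eps_transformed_integrand L Q theta 0 t).
    by move=> /abI It; exact: (is_derive_noether_charge sL oI tq sQ' sth' sol It).
  have sub_oo_cc : {subset `]a, b[%R <= `[a, b]%R}.
    by move=> t; rewrite !in_itv /= => /andP[/ltW -> /ltW ->].
  have cN t : t \in `[a, b]%R -> {for t, continuous (noether_charge L q Q theta)}.
    move=> tI; apply: differentiable_continuous; apply/derivable1_diffP.
    by have [] := dN t tI.
  rewrite /Rintegral (@continuous_FTC2 _ _ (noether_charge L q Q theta)) //.
  - apply: continuous_within_segment => t tI; apply: continuous_section.
    apply: (continuous_d_eps_transformed_integrand sL sQ sth (abI t tI)).
    exact: nbhs_singleton (reg t tI).
  - have [aI bI] : a \in `[a, b]%R /\ b \in `[a, b]%R.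
      by rewrite !in_itv /= !lexx ltW.
    split; first by move=> t /sub_oo_cc /dN[].
      by apply: cvg_at_right_filter; exact: cN.
    by apply: cvg_at_left_filter; exact: cN.
  - by move=> t /sub_oo_cc /dN[_ <-]; rewrite derive1E.
rewrite -int_charge; apply: is_derive_segment_integral => // t tI.
- by have := reg t tI; apply: filterS => x; exact: is_derive_transformed_integrand sL.
- have := reg t tI; apply: filterS => x regx; apply: cvgM.
    exact: continuous_transformed_Lagrangian sL regx.
  by have [_ /differentiable_continuous] := regx.
- apply: (continuous_d_eps_transformed_integrand sL sQ sth (abI t tI)).
  exact: nbhs_singleton (reg t tI).
Qed.

Unset Implicit Arguments.

Theorem theorem9 (R : realType) (n : nat) (n_ge1 : (1 <= n)%N)
    (D : set (R * 'rV[R]_n * 'rV[R]_n)) (L : R * 'rV[R]_n * 'rV[R]_n -> R)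
    (I : set R) (q : R -> 'rV[R]_n)
    (Q : R -> R -> 'rV[R]_n) (theta G : R -> R -> R)
    (D_open : open D) (L_smooth : smooth_on D L)
    (I_open : open I) (I_interval : is_interval I)
    (q_traj : trajectory D I q)
    (Q_change : space_change I q Q)
    (theta_change : time_change I theta)
    (G_BH : BH_function I G)
    (inv : infinitesimal_alternative_BH_invariance L I Q theta G)
    (q_sol : lagrange_equation L I q) :
  forall s t : R, I s -> I t ->
    noether_function L q Q theta G s = noether_function L q Q theta G t.
Proof.
have noetherE t : noether_function L q Q theta G t =
    noether_charge L q Q theta t + d_eps G 0 t by [].
suff lt_case s t : I s -> I t -> s < t ->
    noether_function L q Q theta G s = noether_function L q Q theta G t.
  move=> s t Is It; have [st|ts|-> //] := ltgtP s t; first exact: lt_case.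
  by apply/esym; exact: lt_case.
move=> Is It st; rewrite !noetherE.
have dG u : I u -> is_derive (0 : R) (1 : R) (G ^~ u) (d_eps G 0 u).
  move=> Iu; exact: (is_derive_eps (x := (0, u))
    (nbhs_singleton (smooth_family_differentiable G_BH Iu))).
have dA := is_derive_action D_open L_smooth I_open I_interval q_traj Q_change
  theta_change q_sol Is It st.
have [_ total] := is_deriveB (is_deriveD dA (dG t It)) (dG s Is).
have [_ zero] := inv s t Is It.
have := etrans (esym total) zero; lra.
Qed.
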